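(* Let $(K,\nu)$ be a rank one discrete valued field, normalized so that $\nu(K^* )=\mathbb{Z}$, with valuation ring $R_\nu$, maximal ideal $M_\nu$, residue field $\mathbb{F}_\nu$, and henselization $K^h$. Let $\phi\in R_\nu[x]$ be a monic polynomial of degree $m$ whose reduction $\overline{\phi}$ modulo $M_\nu$ is irreducible in $\mathbb{F}_\nu[x]$. Let $f(x)\in R_\nu[x]$ be a monic polynomial such that $\overline{f(x)}$ is a power of $\overline{\phi}$ in $\mathbb{F}_\nu[x]$, and let $$f(x)=\phi(x)^n+a_{n-1}(x)\phi(x)^{n-1}+\cdots+a_1(x)\phi(x)+a_0(x)$$ be the $\phi$-expansion of $f(x)$ (so each $a_i(x)\in R_\nu[x]$ has $\deg a_i<m$), with $a_0(x)\neq 0$. Put $\lambda=\frac{\nu(a_0)}{n}$ and $d=\gcd(\nu(a_0),n)$. If $\nu(a_i)\ge \nu(a_0)-i\lambda$ for every $i=0,\dots,n-1$, then $f(x)$ has at most $d$ irreducible factors over $K^h$ (counted with multiplicity, i.e. in a factorization of $f$ into monic irreducible factors in $K^h[x]$), and each of these irreducible factors has degree at least $em$, where $e=n/d$.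
   Context: For a polynomial $g(x)\in R_\nu[x]$, $\nu(g)$ denotes the Gauss valuation, i.e. the minimum of the valuations of the coefficients of $g$. The $\phi$-expansion of $f$ is the unique expression $f=\sum_i a_i(x)\phi(x)^i$ with $\deg a_i<\deg\phi$, obtained by successive Euclidean division by $\phi$. *)

(* Defs.v *)
From HB Require Import structures.
From mathcomp Require Import all_boot all_order all_algebra.
From mathcomp Require Import ring_quotient.
From mathcomp Require Import constructive_ereal.

Set Implicit Arguments.
Unset Strict Implicit.
Unset Printing Implicit Defensive.

Import Order.TTheory GRing.Theory Num.Theory.
Local Open Scope ring_scope.

(* Normalized rank one discrete valuations, valued in int extended by +oo;
   the value -oo of \bar int is never taken. *)
Record dvaluation (K : fieldType) := DValuation {
  dval :> K -> \bar int;
  dval_neqNy : forall x, dval x != -oo%E;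
  dval_eqy : forall x, dval x = +oo%E <-> x = 0;
  dvalM : forall x y, dval (x * y) = (dval x + dval y)%E;
  dvalD : forall x y, (Order.min (dval x) (dval y) <= dval (x + y))%E;
  dval_surj : forall z : int, exists x, dval x = z%:E }.

Section ValuationRing.
Variables (K : fieldType) (v : dvaluation K).

Definition vring : {pred K} := [pred x | (0 <= v x)%E].

Lemma dval0 : v 0 = +oo%E.
Proof. exact/dval_eqy. Qed.

Lemma dval_fin x : x != 0 -> exists z, v x = z%:E.
Proof.
move=> x0; have := dval_neqNy v x; have := dval_eqy v x.
by case: (v x) => [z|[/(_ erefl) /eqP]|]; [exists z | rewrite (negPf x0) |].
Qed.

Lemma dval1 : v 1 = 0%E.
Proof.
have [z vz] := dval_fin (oner_neq0 K).
have := dvalM v 1 1; rewrite mulr1 vz -EFinD => -[/eqP].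
by rewrite -subr_eq0 opprD addrA subrr sub0r oppr_eq0 => /eqP ->.
Qed.

Lemma dvalN x : v (- x) = v x.
Proof.
have [z vz] : exists z, v (-1) = z%:E by apply: dval_fin; rewrite oppr_eq0 oner_neq0.
rewrite -mulN1r dvalM; suff -> : v (-1) = 0%E by rewrite add0e.
have := dvalM v (-1) (-1); rewrite mulrNN mulr1 dval1 vz -EFinD => -[/eqP].
by rewrite eq_sym -mulr2n mulrn_eq0 /= => /eqP ->.
Qed.

Lemma vring_subring_closed : subring_closed vring.
Proof.
split=> [|x y|x y]; rewrite !inE ?dval1 // => x0 y0.
  by apply: le_trans (dvalD v x (- y)); rewrite le_min x0 dvalN.
by rewrite dvalM adde_ge0.
Qed.

HB.instance Definition _ :=
  GRing.isSubringClosed.Build K vring vring_subring_closed.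

(* The valuation ring as a type, so that R_v[x] is {poly vint v}. *)
Record vint := VInt { vint_val : K; _ : vint_val \in vring }.
HB.instance Definition _ := [isSub for vint_val].
HB.instance Definition _ := [Choice of vint by <:].
HB.instance Definition _ := [SubChoice_isSubComNzRing of vint by <:].

Definition vmax : {pred vint} := [pred x | (0 < v (val x))%E].

Lemma vmax_idealr_closed : idealr_closed vmax.
Proof.
split=> [||a x y]; rewrite !inE ?rmorph0 ?rmorph1 ?dval0 ?dval1 ?ltxx ?lt0y //.
move=> x0 y0; rewrite rmorphD rmorphM /=.
apply: lt_le_trans (dvalD v _ _); rewrite lt_min y0 andbT dvalM.
exact: lt_le_trans x0 (leeDr _ (valP a)).
Qed.

HB.instance Definition _ := isIdealr.Build vint vmax vmax_idealr_closed.

Definition residue := {ideal_quot vmax}.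
HB.instance Definition _ := GRing.ComNzRing.on residue.

Definition red : vint -> residue := \pi_({ideal_quot vmax})%qT.
HB.instance Definition _ := GRing.RMorphism.on red.

Definition vint_inv (x : vint) : vint := insubd x (val x)^-1.
Definition residue_inv (x : residue) : residue :=
  if x == 0 then 0 else red (vint_inv (repr x)).

Lemma redK (x : residue) : red (repr x) = x.
Proof. exact: reprK. Qed.

Lemma red_eq0 (x : vint) : (red x == 0) = (x \in vmax).
Proof. by rewrite -(rmorph0 red) -Quotient.idealrBE subr0. Qed.

Lemma residue_mulVx (x : residue) : x != 0 -> residue_inv x * x = 1.
Proof.
move=> x0; rewrite /residue_inv (negPf x0) -[X in _ * X]redK -rmorphM.
have := x0; rewrite -[x in x != 0]redK red_eq0 inE -leNgt => vx.
have {}vx : v (val (repr x)) = 0%E.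
  by apply/eqP; rewrite eq_le vx; exact: (valP (repr x)).
have r0 : val (repr x) != 0 by apply/eqP => r0; rewrite r0 dval0 in vx.
rewrite -[RHS](rmorph1 red); congr red; apply/val_inj.
rewrite rmorphM rmorph1 /= /vint_inv val_insubd inE.
have := dvalM v (val (repr x))^-1 (val (repr x)).
by rewrite mulVf // dval1 vx adde0 => <-; rewrite lexx mulVf.
Qed.

Lemma residue_inv0 : residue_inv 0 = 0.
Proof. by rewrite /residue_inv eqxx. Qed.

HB.instance Definition _ :=
  GRing.ComNzRing_isField.Build residue residue_mulVx residue_inv0.

Definition gauss (g : {poly vint}) : \bar int :=
  \big[Order.min/+oo%E]_(i < size g) v (val g`_i).

End ValuationRing.

(* Arbitrary valued fields (any value group) are represented by their
   valuation rings. *)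
Section ValuedFields.
Variables (L : fieldType) (O : {pred L}).

Definition valuation_subring : Prop :=
  subring_closed O /\ forall x, (x \in O) || (x^-1 \in O).

(* Nonunits of O. *)
Definition maximal_of : {pred L} :=
  [pred x | (x \in O) && ((x == 0) || (x^-1 \notin O))].

(* Hensel's lemma: simple residual roots of monic polynomials lift. *)
Definition henselian : Prop :=
  valuation_subring /\
  forall (p : {poly L}) (a : L),
    p \is monic -> p \is a polyOver O -> a \in O ->
    p.[a] \in maximal_of -> p^`().[a] \notin maximal_of ->
    exists b, [/\ b \in O, root p b & b - a \in maximal_of].

End ValuedFields.

Definition valued_embedding (K L : fieldType) (OK : {pred K}) (OL : {pred L})
    (j : {rmorphism K -> L}) : Prop :=
  forall x, (j x \in OL) = (x \in OK).

(* Initial among henselian valued extensions of (K, OK); an embedding is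
   compatible with the valuations when OL pulls back to OK. *)
Definition is_henselization (K Kh : fieldType) (OK : {pred K}) (Oh : {pred Kh})
    (iota : {rmorphism K -> Kh}) : Prop :=
  [/\ henselian Oh, valued_embedding OK Oh iota &
      forall (L : fieldType) (OL : {pred L}) (j : {rmorphism K -> L}),
        henselian OL -> valued_embedding OK OL j ->
        exists psi : {rmorphism Kh -> L},
          [/\ valued_embedding Oh OL psi, psi \o iota =1 j &
              forall psi' : {rmorphism Kh -> L},
                valued_embedding Oh OL psi' -> psi' \o iota =1 j ->
                psi' =1 psi]].

(* Main.v *)
(* The elements of K^h that are algebraic over K and are limits of elements of K
   form a henselian subfield, so by the universal property K^h maps into it over
   K. Hence a monic factorization f = g h over K^h may be approximated by a
   factorization over R_v modulo an arbitrarily large power of a uniformizer pi,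
   with the same degrees.  The reduction of g is a power of that of phi, so that
   deg g = k m.  Comparing the phi-expansions G, H, A of g, h, f, the polynomial
   G H - A in Y vanishes (up to a high power of pi) at Y = phi, hence is a
   multiple of Y - phi; looking at its initial part for the weight
   n v(c) + i v(a_0) on c Y^i shows that the Newton polygons of G and H have the
   single slope v(a_0) / n, and that the constant term of G has valuation
   k v(a_0) / n.  As this is an integer, e divides k. *)

Require Import Defs.
From HB Require Import structures.
From mathcomp Require Import all_boot all_order all_algebra.
From mathcomp Require Import zify ring.
From mathcomp Require Import boolp constructive_ereal.

Set Implicit Arguments.
Unset Strict Implicit.
Unset Printing Implicit Defensive.

Import Order.TTheory GRing.Theory Num.Theory.
Local Open Scope ring_scope.

(** * Subfields as field types, and corestriction of field morphisms to them *)

Section SubField.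
Variable L : fieldType.

(* The closedness proof is a phantom argument, so that unification can find
   the instances below. *)
Definition subfield_pred (F : {pred L}) (hF : divring_closed F) : {pred L} := F.
HB.instance Definition _ (F : {pred L}) (hF : divring_closed F) :=
  GRing.isDivringClosed.Build L (subfield_pred hF) hF.

Record subfield (F : {pred L}) (hF : divring_closed F) :=
  SubFieldElt { subfield_val : L; _ : subfield_val \in subfield_pred hF }.

Variables (F : {pred L}) (hF : divring_closed F).
HB.instance Definition _ := [isSub for @subfield_val F hF].
HB.instance Definition _ := [Choice of subfield hF by <:].
HB.instance Definition _ := [SubChoice_isSubIntegralDomain of subfield hF by <:].
HB.instance Definition _ := [SubIntegralDomain_isSubField of subfield hF by <:].

Variables (K : fieldType) (iota : {rmorphism K -> L}).
Hypothesis iotaF : forall x, iota x \in F.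

Definition subfield_lift (x : K) : subfield hF := Sub (iota x) (iotaF x).

Lemma subfield_lift_zmod : zmod_morphism subfield_lift.
Proof. by move=> x y; apply: val_inj; rewrite rmorphB /= rmorphB. Qed.

Lemma subfield_lift_monoid : monoid_morphism subfield_lift.
Proof.
split=> [|x y]; apply: val_inj; first by rewrite rmorph1 /= rmorph1.
by rewrite rmorphM /= rmorphM.
Qed.

HB.instance Definition _ :=
  GRing.isZmodMorphism.Build K (subfield hF) subfield_lift subfield_lift_zmod.
HB.instance Definition _ :=
  GRing.isMonoidMorphism.Build K (subfield hF) subfield_lift
    subfield_lift_monoid.

End SubField.

(** * Valuation rings of arbitrary rank and their maximal ideals *)

Section ValuationSubring.
Variables (L : fieldType) (O : {pred L}).

Definition valuation_pred (hO : valuation_subring O) : {pred L} := O.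
HB.instance Definition _ (hO : valuation_subring O) :=
  GRing.isSubringClosed.Build L (valuation_pred hO) (proj1 hO).

Hypothesis hO : valuation_subring O.
Local Notation S := (valuation_pred hO).
Local Notation M := (maximal_of O).

Lemma maximal_sub x : x \in M -> x \in O.
Proof. by case/andP. Qed.

Lemma notin_maximal x : x \in O -> x \notin M -> x != 0 /\ x^-1 \in O.
Proof. by move=> xO; rewrite inE xO negb_or negbK => /andP[]. Qed.

Lemma notin_valuation x : x \notin O -> x != 0 /\ x^-1 \in M.
Proof.
move=> xO; have [x0|x0] := eqVneq x 0.
  by rewrite x0 (rpred0 S) in xO.
by split=> //; case: hO => _ /(_ x); rewrite (negPf xO) inE invrK xO orbT /= => ->.
Qed.

(** If [x * y] were a unit of [O], then [y^-1 = x * (x * y)^-1] would lie in [O]. *)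
Lemma maximalM x y : x \in O -> y \in M -> x * y \in M.
Proof.
move=> xO yM; have yO := maximal_sub yM.
rewrite inE (@rpredM _ S) //=; have [//|] := eqVneq (x * y) 0.
rewrite mulf_eq0 negb_or => /andP[x0 y0] /=; apply: contraL yM => xyO.
rewrite inE (negPf y0) negb_and /= negbK; apply/orP; right.
have -> : y^-1 = x * (x * y)^-1 by field; rewrite x0 y0.
exact: (@rpredM _ S).
Qed.

(** One of [x / y] and [y / x] lies in [O], so by symmetry [x / y] may be taken there; if [x + y]
    were a unit, then [y^-1 = (1 + x / y) * (x + y)^-1] would be in [O]. *)
Lemma maximalD x y : x \in M -> y \in M -> x + y \in M.
Proof.
wlog xy : x y / x / y \in O => [hw xM yM|xM yM].
  have [xy|/notin_valuation[_ xy]] := boolP (x / y \in O); first exact: hw.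
  by rewrite addrC; apply: hw => //; move/maximal_sub: xy; rewrite invf_div.
have [y0|y0] := eqVneq y 0; first by rewrite y0 addr0.
rewrite inE (@rpredD _ S) ?(maximal_sub xM) ?(maximal_sub yM) //=.
have [//|xy0 /=] := eqVneq (x + y) 0.
apply: contraL yM => xyO; rewrite inE (negPf y0) negb_and negbK /=.
apply/orP; right; have -> : y^-1 = (1 + x / y) * (x + y)^-1.
  by field; rewrite xy0 y0.
by apply: (@rpredM _ S) => //; apply: (@rpredD _ S) => //; apply: (rpred1 S).
Qed.

Lemma maximalN x : x \in M -> - x \in M.
Proof. by rewrite -mulN1r; apply: maximalM; apply: (rpredN1 S). Qed.

Lemma maximal1 : 1 \notin M.
Proof. by rewrite inE oner_eq0 invr1 /= andbN. Qed.

Lemma maximal0 : 0 \in M.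
Proof. by rewrite inE eqxx (rpred0 S). Qed.

Lemma maximal_unit x y : x \in M -> y \notin M -> x + y \notin M.
Proof.
by move=> xM; apply: contra => xyM; rewrite -(addKr x y) maximalD // maximalN.
Qed.

(** Dividing [p.[z] = 0] by the leading power of [z] would write 1 as a sum of elements of [M]. *)
Lemma nonroot_large (p : {poly L}) z : p \is monic -> z != 0 -> z^-1 \in M ->
  (forall i, p`_i / z \in M) -> ~~ root p z.
Proof.
move=> pm z0 zM pz; apply/negP => /rootP.
rewrite horner_coef; have := monic_neq0 pm; rewrite -size_poly_gt0.
have := pm; rewrite monicE lead_coefE; case: (size p) => [//|d] /= /eqP pd _.
rewrite big_ord_recr /= pd mul1r => /(canRL (addKr _)) zd.
have /negP[] := maximal1.
have -> : 1 = - \sum_(i < d) p`_i / z * z^-1 ^+ (d - i.+1).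
  apply: (mulIf (expf_neq0 d z0)); rewrite mul1r [LHS]zd mulNr addr0 mulr_suml.
  congr (- _); apply: eq_bigr => i _.
  have -> : z ^+ d = z ^+ (d - i.+1) * z * z ^+ i.
    by rewrite -exprSr -exprD addSnnS subnK.
  by rewrite exprVn; field; rewrite expf_neq0 ?z0.
apply: maximalN; elim/big_ind: _ => [|x y|i _]; first exact: maximal0.
  exact: maximalD.
rewrite mulrC maximalM // (@rpredX _ S) //; exact: maximal_sub.
Qed.

Lemma taylor2 (p : {poly L}) x h : p \is a polyOver O -> x \in O -> h \in O ->
  exists2 q, q \in O & p.[x + h] = p.[x] + p^`().[x] * h + q * h ^+ 2.
Proof.
move=> pO xO hO'; exists (\sum_(i < size p) p^`N(i.+2).[x] * h ^+ i).
  apply: (@rpred_sum _ S) => i _; apply: (@rpredM _ S).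
    by apply: (@rpred_horner _ S) => //; apply: (@polyOver_nderivn _ S).
  exact: (@rpredX _ S).
rewrite (@nderiv_taylor_wide _ (size p).+2) ?leqW //; last exact: mulrC.
rewrite !big_ord_recl /= nderivn0 nderivn1 expr0 expr1 mulr1 addrA; congr (_ + _).
rewrite mulr_suml; apply: eq_bigr => i _.
by rewrite /bump /= !add1n -mulrA -exprD addn2.
Qed.

End ValuationSubring.

(** * Powers of a uniformizer in a discrete valued field *)

Section Valuation.
Variables (K : fieldType) (v : dvaluation K).

Lemma dvalX x (z : int) N : v x = z%:E -> v (x ^+ N) = (z *+ N)%:E.
Proof.
move=> vx; elim: N => [|N IH]; first by rewrite expr0 dval1 mulr0n.
by rewrite exprS dvalM vx IH -EFinD mulrS.
Qed.

Lemma dvalV x (z : int) : v x = z%:E -> v x^-1 = (- z)%:E.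
Proof.
move=> vx; have x0 : x != 0 by apply/eqP => x0; move: vx; rewrite x0 dval0.
have [y vy] : exists y, v x^-1 = y%:E by apply: dval_fin; rewrite invr_eq0.
have := dvalM v x x^-1; rewrite divff // dval1 vx vy -EFinD => -[/esym/eqP].
by rewrite addrC addr_eq0 => /eqP ->.
Qed.

Variable pi : K.
Hypothesis vpi : v pi = 1%:E.

Lemma uniformizer_neq0 : pi != 0.
Proof. by apply/eqP => p0; move: vpi; rewrite p0 dval0. Qed.

Lemma dval_pi N : v (pi ^+ N) = N%:Z%:E.
Proof. by rewrite (dvalX N vpi) natz. Qed.

Lemma vring_div_pi x N : (x / pi ^+ N \in vring v) = (N%:Z%:E <= v x)%E.
Proof.
rewrite inE dvalM (dvalV (dval_pi N)); case: (v x) (dval_neqNy v x) => //= z _.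
by rewrite -EFinD !lee_fin subr_ge0.
Qed.

Lemma vring_clear x : exists N, x * pi ^+ N \in vring v.
Proof.
have [->|x0] := eqVneq x 0; first by exists 0%N; rewrite mul0r rpred0.
have [z vz] := dval_fin v x0; exists `|z|%N.
by rewrite inE dvalM vz dval_pi -EFinD lee_fin; lia.
Qed.

Lemma vring_clear_seq (s : seq K) :
  exists N, forall x, x \in s -> x * pi ^+ N \in vring v.
Proof.
elim: s => [|x s [N IH]]; first by exists 0%N.
have [N' hx] := vring_clear x; exists (N' + N)%N => y.
have piO n : pi ^+ n \in vring v by rewrite inE dval_pi lee_fin.
rewrite inE exprD => /predU1P[->|/IH ys]; first by rewrite mulrA rpredM.
by rewrite mulrCA rpredM.
Qed.

End Valuation.

(** * The elements algebraic over [K] that are limits of elements of [K] *)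

Section Dense.
Variables (K : fieldType) (v : dvaluation K) (L : fieldType) (O : {pred L}).
Variable iota : {rmorphism K -> L}.
Hypotheses (hO : valuation_subring O).
Hypothesis iotaO : valued_embedding (vring v) O iota.
Variable pi : K.
Hypothesis vpi : v pi = 1%:E.
Local Notation S := (valuation_pred hO).
Local Notation M := (maximal_of O).
Local Notation P := (iota pi).

(** The closure of [K] when the sets [P ^+ N * O] are the basic neighbourhoods of 0. The value group
    of [O] is arbitrary, so this topology may be coarser than that of the valuation. *)
Definition adherent (x : L) := forall N, exists a, (x - iota a) / P ^+ N \in O.

Lemma pi_neq0 : P != 0.
Proof. by rewrite fmorph_eq0 (uniformizer_neq0 vpi). Qed.
Local Hint Resolve pi_neq0 : core.

Lemma piX_neq0 N : P ^+ N != 0.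
Proof. exact: expf_neq0. Qed.
Local Hint Resolve piX_neq0 : core.

Lemma piX_in N : P ^+ N \in O.
Proof. by rewrite -rmorphXn iotaO inE (dval_pi vpi) lee_fin. Qed.

Lemma pi_maximal : P \in M.
Proof.
rewrite inE -[P]expr1 piX_in /= expr1 (negPf pi_neq0) /= -fmorphV iotaO inE.
by rewrite (dvalV vpi).
Qed.

Lemma adherentK a : adherent (iota a).
Proof. by move=> N; exists a; rewrite subrr mul0r (rpred0 S). Qed.

Lemma adherentB x y : adherent x -> adherent y -> adherent (x - y).
Proof.
move=> hx hy N; have [a ha] := hx N; have [b hb] := hy N; exists (a - b).
have -> : x - y - iota (a - b) = (x - iota a) - (y - iota b) by rewrite rmorphB; ring.
by rewrite mulrBl; apply: (@rpredB _ S).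
Qed.

Lemma iota_clear a : exists N, iota a * P ^+ N \in O.
Proof.
have [N hN] := vring_clear vpi a; exists N.
by rewrite -rmorphXn -rmorphM iotaO.
Qed.

Lemma adherent_clear x : adherent x -> exists N, x * P ^+ N \in O.
Proof.
move=> /(_ 0%N) [a]; rewrite expr0 divr1 => ha.
have [N hN] := iota_clear a; exists N.
rewrite -(subrK (iota a) x) mulrDl (@rpredD _ S) //.
by apply: (@rpredM _ S) => //; apply: piX_in.
Qed.

(** From [x * y - a * b = x * (y - b) + (x - a) * b]: the precision of each approximation is raised
    by the power of [P] that clears the other factor. *)
Lemma adherentM x y : adherent x -> adherent y -> adherent (x * y).
Proof.
move=> hx hy N; have [B hB] := adherent_clear hx.
have [b hb] := hy (N + B)%N; have [C hC] := iota_clear b.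
have [a ha] := hx (N + C)%N; exists (a * b).
have -> : (x * y - iota (a * b)) / P ^+ N
    = x * P ^+ B * ((y - iota b) / P ^+ (N + B))
      + (x - iota a) / P ^+ (N + C) * (iota b * P ^+ C).
  by rewrite rmorphM !exprD; field; rewrite !piX_neq0.
by apply: (@rpredD _ S); apply: (@rpredM _ S).
Qed.

(** In higher rank no power of [P] need clear [x^-1], hence the explicit bound [B]. The inverse of
    an approximation [a] of [x] works, by [x^-1 - a^-1 = (a - x) / (x * a)]. *)
Lemma adherentV x B : x != 0 -> x^-1 * P ^+ B \in O -> adherent x -> adherent x^-1.
Proof.
(* Each of the two factors [x^-1] costs [P ^+ B]; the extra power of [P] makes [iota a / x]
   congruent to 1 modulo [M], hence a unit. *)
move=> x0 hB hx N; have [a ha] := hx (N + (B + B) + 1)%N.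
set o := _ / _ in ha.
have xa : iota a = x - o * P ^+ (N + (B + B) + 1).
  by rewrite /o divfK // opprB addrC subrK.
have axE : iota a / x = - (o * P ^+ N * P ^+ B * (x^-1 * P ^+ B) * P) + 1.
  by rewrite xa !exprD expr1; field.
have oM : - (o * P ^+ N * P ^+ B * (x^-1 * P ^+ B) * P) \in M.
  apply: (maximalN hO); apply: (maximalM hO); last exact: pi_maximal.
  by do 3?[apply: (@rpredM _ S) => //]; apply: piX_in.
have ax : iota a / x \notin M by rewrite axE (maximal_unit hO) // maximal1.
have axO : iota a / x \in O.
  by rewrite axE; apply: (@rpredD _ S); [apply: maximal_sub|apply: (rpred1 S)].
have [ax0 xaO] := notin_maximal axO ax.
have a0 : iota a != 0 by apply: contraNneq ax0 => ->; rewrite mul0r.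
exists a^-1; rewrite fmorphV.
have -> : (x^-1 - (iota a)^-1) / P ^+ N
    = - (o * P * (x^-1 * P ^+ B) * (x^-1 * P ^+ B) * (iota a / x)^-1).
  have -> : x^-1 - (iota a)^-1 = (iota a - x) / (x * iota a).
    by field; rewrite x0 a0.
  by rewrite {1}xa !exprD expr1; field; rewrite x0 a0 !piX_neq0.
rewrite (@rpredN _ S); do 4?[apply: (@rpredM _ S) => //].
by rewrite -[P]expr1 piX_in.
Qed.

(** If [P ^+ N] clears the coefficients of a monic equation of [z] over [K] and [z * P ^+ N.+1] is
    not integral, then [z] is too large to be a root, by [nonroot_large]. *)
Lemma algebraic_clear z : algebraicOver iota z -> exists N, z * P ^+ N \in O.
Proof.
move=> /integral_algebraic[p pm pz]; have [N hN] := vring_clear_seq vpi p.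
exists N.+1; apply: contraTT pz => zO.
have [zN0 zNM] := notin_valuation hO zO.
apply: (nonroot_large hO); first by rewrite monic_map.
- by apply: contraNneq zN0 => ->; rewrite mul0r.
- have -> : z^-1 = P ^+ N.+1 * (z * P ^+ N.+1)^-1.
    field; rewrite ?piX_neq0 ?pi_neq0 /=; apply: contraNneq zN0 => ->; by rewrite mul0r.
  by apply: (maximalM hO) => //; apply: piX_in.
move=> i; rewrite coef_map /=.
have -> : iota p`_i / z = iota (p`_i * pi ^+ N) * P * (z * P ^+ N.+1)^-1.
  rewrite rmorphM rmorphXn exprS; field; rewrite ?piX_neq0 ?pi_neq0 /=.
  by apply: contraNneq zN0 => ->; rewrite mul0r.
apply: (maximalM hO) => //; apply: (@rpredM _ S); last by rewrite -[P]expr1 piX_in.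
rewrite /= /valuation_pred iotaO; have [ip|ip] := ltnP i (size p).
  by apply: hN; apply: mem_nth.
by rewrite nth_default // mul0r rpred0.
Qed.

(** Discreteness of [v] enters here: an approximation of [x] by an element of [K] has positive,
    hence at least unit, valuation. *)
Lemma adherent_maximal x : adherent x -> x \in M -> x / P \in O.
Proof.
move=> /(_ 1%N) [a]; rewrite expr1 => ha xM.
have aM : iota a \in M.
  have -> : iota a = x - (x - iota a) / P * P by rewrite divfK // opprB addrC subrK.
  apply: (maximalD hO) => //; apply: (maximalN hO).
  by apply: (maximalM hO) => //; apply: pi_maximal.
rewrite -(subrK (iota a) x) mulrDl (@rpredD _ S) //.
rewrite /= /valuation_pred -fmorphV -rmorphM iotaO -[pi]expr1 (vring_div_pi vpi).
move: aM; rewrite inE -fmorphV !iotaO fmorph_eq0 !inE.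
have [->|a0] := eqVneq a 0; first by rewrite dval0.
have [z vz] := dval_fin v a0; rewrite (dvalV vz) vz !lee_fin; lia.
Qed.

(** Algebraicity gives closure under inverses, through the bound of [algebraic_clear]. *)
Definition dense_part : {pred L} :=
  [pred x | `[< algebraicOver iota x /\ adherent x >]].

Lemma dense_partP x :
  reflect (algebraicOver iota x /\ adherent x) (x \in dense_part).
Proof. exact: asboolP. Qed.

Lemma dense_part_divring : divring_closed dense_part.
Proof.
split=> [|x y /dense_partP[xa xd] /dense_partP[ya yd]
         |x y /dense_partP[xa xd] /dense_partP[ya yd]]; apply/dense_partP.
- by rewrite -(rmorph1 iota); split; [apply: algebraic_id|apply: adherentK].
- by split; [apply: algebraic_sub|apply: adherentB].
split; first exact: algebraic_div.
have [->|y0] := eqVneq y 0.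
  by rewrite invr0 mulr0 -(rmorph0 iota); apply: adherentK.
apply: adherentM => //; have [B hB] := algebraic_clear (algebraic_inv ya).
exact: adherentV hB yd.
Qed.

Lemma dense_part_iota a : iota a \in dense_part.
Proof. by apply/dense_partP; split; [apply: algebraic_id|apply: adherentK]. Qed.

End Dense.

(** * Hensel's lemma for the algebraic limits of elements of [K] *)

Section Hensel.
Variables (K : fieldType) (v : dvaluation K) (L : fieldType) (O : {pred L}).
Variable iota : {rmorphism K -> L}.
Hypotheses (hO : valuation_subring O).
Hypothesis iotaO : valued_embedding (vring v) O iota.
Variable pi : K.
Hypothesis vpi : v pi = 1%:E.
Local Notation S := (valuation_pred hO).
Local Notation M := (maximal_of O).
Local Notation P := (iota pi).
Local Notation F := (dense_part O iota pi).
Let hF := dense_part_divring hO iotaO vpi.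
Local Notation FS := (subfield_pred hF).

(** Newton's iteration started at [a] stays in [F] and converges to the root [b]. *)
Lemma hensel_adherent (p : {poly L}) a b :
    p \is a polyOver O -> p \is a polyOver F -> a \in O -> a \in F ->
    p.[a] \in M -> p^`().[a] \notin M -> b \in O -> root p b -> b - a \in M ->
  adherent O iota pi b.
Proof.
move=> pO pF aO aF pa dpa bO /rootP pb baM.
have PO : P \in O by apply: maximal_sub; apply: (pi_maximal iotaO vpi).
have PXO N : P ^+ N \in O by exact: (piX_in iotaO vpi).
have P0 : P != 0 := pi_neq0 iota vpi.
have PX0 N : P ^+ N != 0 by exact: expf_neq0.
have dpO : p^`() \is a polyOver O by apply: (@polyOver_deriv _ S).
have dpF : p^`() \is a polyOver F by apply: (@polyOver_deriv _ FS).
have hornerO q x : q \is a polyOver O -> x \in O -> q.[x] \in O.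
  exact: (@rpred_horner _ S).
have hornerF q x : q \is a polyOver F -> x \in F -> q.[x] \in F.
  exact: (@rpred_horner _ FS).
have newton k : exists y, [/\ y \in F, y \in O & (b - y) / P ^+ k.+1 \in O].
  elim: k => [|k [y [yF yO hy]]].
    (* Taylor's formula at [a] gives [b - a = - p.[a] / u] with [u] a unit, and [p.[a]], being
       adherent and in [M], is divisible by [P]. *)
    exists a; split=> //; rewrite expr1.
    have [q qO] := taylor2 hO pO aO (maximal_sub baM).
    rewrite [a + _]addrC subrK pb => tay.
    have uM : q * (b - a) + p^`().[a] \notin M.
      by apply: (maximal_unit hO) => //; apply: (maximalM hO).
    have uO : q * (b - a) + p^`().[a] \in O.
      apply: (@rpredD _ S); last exact: hornerO.
      by apply: (@rpredM _ S) => //; apply: maximal_sub.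
    have [u0 uV] := notin_maximal uO uM.
    have -> : (b - a) / P = - (p.[a] / P * (q * (b - a) + p^`().[a])^-1).
      have -> : p.[a] = - ((q * (b - a) + p^`().[a]) * (b - a)).
        by apply/eqP; rewrite -addr_eq0 [X in _ == X]tay; apply/eqP; ring.
      by field; rewrite P0 u0.
    rewrite (@rpredN _ S) (@rpredM _ S) //.
    apply: (adherent_maximal hO iotaO vpi) => //.
    by have /dense_partP[] := hornerF _ _ pF aF.
  have hyM : b - y \in M.
    have -> : b - y = (b - y) / P ^+ k.+1 * P ^+ k * P.
      by rewrite -mulrA -exprSr divfK.
    apply: (maximalM hO); last exact: (pi_maximal iotaO vpi).
    exact: (@rpredM _ S).
  have dyM : p^`().[y] \notin M.
    have yaM : y - a \in M.
      have -> : y - a = (b - a) - (b - y) by ring.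
      by apply: (maximalD hO) => //; apply: (maximalN hO).
    have [q qO] := taylor2 hO dpO aO (maximal_sub yaM).
    rewrite [a + _]addrC subrK => ->.
    rewrite -addrA addrC; apply: (maximal_unit hO) => //.
    apply: (maximalD hO); first by apply: (maximalM hO) => //; apply: hornerO;
      [apply: (@polyOver_deriv _ S)|].
    by rewrite expr2 mulrA; apply: (maximalM hO) => //;
       apply: (@rpredM _ S) => //; apply: maximal_sub.
  have [d0 dV] := notin_maximal (hornerO _ _ dpO yO) dyM.
  have [q qO] := taylor2 hO pO yO (maximal_sub hyM).
  rewrite [y + _]addrC subrK pb => tay.
  (* A Newton step squares the error; of the resulting [2 * k.+1] powers of [P] only [k.+2] are
     retained. *)
  have yE : b - (y - p.[y] / p^`().[y])
      = - (q * ((b - y) / P ^+ k.+1) ^+ 2 * P ^+ k * p^`().[y]^-1) * P ^+ k.+2.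
    have -> : p.[y] = - (p^`().[y] * (b - y) + q * (b - y) ^+ 2).
      by apply/eqP; rewrite -addr_eq0 [X in _ == X]tay; apply/eqP; ring.
    by rewrite !exprS; field; rewrite d0 P0 PX0.
  have rO : - (q * ((b - y) / P ^+ k.+1) ^+ 2 * P ^+ k * p^`().[y]^-1) \in O.
    rewrite (@rpredN _ S); do 3?[apply: (@rpredM _ S) => //].
    exact: (@rpredX _ S).
  exists (y - p.[y] / p^`().[y]); split.
  - apply: (@rpredB _ FS) => //; apply: (@rpred_div _ FS); exact: hornerF.
  - have -> : y - p.[y] / p^`().[y] = b - (b - (y - p.[y] / p^`().[y])) by ring.
    by rewrite yE; apply: (@rpredB _ S) => //; apply: (@rpredM _ S).
  - by rewrite yE mulfK.
move=> N; have [y [/dense_partP[_ /(_ N)[c hc]] _ hy]] := newton N.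
exists c; have -> : b - iota c = (b - y) + (y - iota c) by ring.
rewrite mulrDl; apply: (@rpredD _ S) => //.
have -> : (b - y) / P ^+ N = (b - y) / P ^+ N.+1 * P.
  by rewrite exprS; field; rewrite P0 PX0.
exact: (@rpredM _ S).
Qed.

(** The root found in [L] is algebraic over [K], as the coefficients are, and adherent by
    [hensel_adherent]. *)
Lemma dense_part_henselian :
  henselian O -> henselian [pred x : subfield hF | val x \in O].
Proof.
case=> _ hens; have hOF : valuation_subring [pred x : subfield hF | val x \in O].
  split; last by move=> x; rewrite !inE fmorphV /=; case: hO => _; apply.
  split=> [|x y|x y]; rewrite !inE ?rmorph1 ?rmorphB ?rmorphM /=.
  + exact: (rpred1 S).
  + exact: (@rpredB _ S).
  + exact: (@rpredM _ S).
split=> //; have maxE (x : subfield hF) :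
    (x \in maximal_of [pred x : subfield hF | val x \in O]) = (val x \in M).
  by rewrite !inE fmorphV /=. 
move=> p a pm pO aO; rewrite !maxE => pa dpa.
pose q := map_poly val p.
have qO : q \is a polyOver O.
  apply/(@polyOverP _ S) => i; rewrite coef_map.
  by have /(@polyOverP _ (valuation_pred hOF))/(_ i) := pO.
have qF : q \is a polyOver F.
  apply/(@polyOverP _ FS) => i; rewrite coef_map; exact: valP.
rewrite -horner_map /= in pa; rewrite -horner_map -deriv_map /= in dpa.
have qm : q \is monic by rewrite monic_map.
have [b [bO qb baM]] := hens q (val a) qm qO aO pa dpa.
have bF : b \in F.
  apply/dense_partP; split; last first.
    exact: (hensel_adherent qO qF aO (valP a)) baM.
  apply/integral_algebraic; apply: (integral_root_monic qm qb).
  move=> x /(nthP 0)[i _ <-]; apply/integral_algebraic.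
  by have /(polyOverP (S := FS))/(_ i)/dense_partP[] := qF.
exists (Sub b bF); split=> //.
by move: qb; rewrite -[b]/(val (Sub b bF : subfield hF)) fmorph_root.
Qed.

End Hensel.

(* The elements of the henselization that are algebraic over K and limits of
   elements of K form a henselian field, so the henselization maps into it. *)
Lemma henselization_adherent (K : fieldType) (v : dvaluation K)
    (Kh : fieldType) (Oh : {pred Kh}) (iota : {rmorphism K -> Kh}) (pi : K) :
    is_henselization (vring v) Oh iota -> v pi = 1%:E ->
  exists psi : {rmorphism Kh -> Kh},
    psi \o iota =1 iota /\ forall x, adherent Oh iota pi (psi x).
Proof.
move=> [hens iotaO univ] vpi; have hO := proj1 hens.
pose hF := dense_part_divring hO iotaO vpi.
have iotaF a : iota a \in dense_part Oh iota pi by exact: dense_part_iota.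
pose j : {rmorphism K -> subfield hF} := subfield_lift hF iotaF.
have [|psi [_ psij _]] := univ _ _ j (dense_part_henselian hO iotaO vpi hens).
  by move=> x; rewrite inE iotaO.
exists (val \o psi); split=> [x|x] /=.
  by have /(congr1 val) := psij x.
by have /dense_partP[] := valP (psi x).
Qed.

(** * Divisibility by powers of the uniformizer, and weights of coefficients *)

Section Weights.
Variables (K : fieldType) (v : dvaluation K).
Local Notation R := (vint v).
Local Notation rp := (map_poly (@red K v)).
Variable pi : R.
Hypothesis vpi : v (val pi) = 1%:E.

Lemma vmax_pi (x : R) : x \in @vmax K v -> exists y, x = pi * y.
Proof.
rewrite inE => x0; have y0 : val x / val pi \in vring v.
  rewrite -[val pi]expr1 (vring_div_pi vpi); move: x0.
  by case: (v (val x)) => [z| |] //; rewrite !lte_fin !lee_fin; lia.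
exists (VInt y0); apply: val_inj; rewrite rmorphM /= mulrC divfK //.
exact: uniformizer_neq0 vpi.
Qed.

Lemma red_pi : red pi = 0.
Proof. by apply/eqP; rewrite red_eq0 inE vpi lte_fin. Qed.

Lemma map_red_eq0 (p : {poly R}) : rp p = 0 -> exists q, p = pi *: q.
Proof.
move=> /polyP rp0; have hc i : exists y, p`_i = pi * y.
  by apply: vmax_pi; rewrite -red_eq0 -coef_map rp0 coef0.
have [c cP] := choice hc; exists (\poly_(i < size p) c i).
apply/polyP => i; rewrite coefZ coef_poly; case: ltnP => [//|ip].
by rewrite nth_default // mulr0.
Qed.

Lemma map_red_scale_pi t (p : {poly R}) : (0 < t)%N -> rp (pi ^+ t *: p) = 0.
Proof. by case: t => // t _; rewrite map_polyZ rmorphXn /= red_pi expr0n scale0r. Qed.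

Lemma scale_piX_inj t : injective (fun p : {poly R} => pi ^+ t *: p).
Proof.
move=> p q /polyP pq; apply/polyP => i; have := pq i; rewrite !coefZ.
move=> /(congr1 val); rewrite !rmorphM !rmorphXn => /mulfI h; apply: val_inj.
by apply: h; rewrite expf_neq0 // (uniformizer_neq0 vpi).
Qed.

(** The residue polynomial ring is a domain in which a monic [phi] stays nonzero, so a factor [pi]
    of [phi * E] divides [E]; induction on [t]. *)
Lemma monic_mul_pi (phi E Q : {poly R}) t : phi \is monic ->
  phi * E = pi ^+ t *: Q -> exists2 E', E = pi ^+ t *: E' & phi * E' = Q.
Proof.
move=> phim; elim: t E Q => [|t IH] E Q.
  by rewrite expr0 scale1r => EQ; exists E; rewrite ?scale1r.
move=> EQ; have [E1 EE1] : exists E1, E = pi *: E1.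
  apply: map_red_eq0; have := congr1 rp EQ; rewrite map_red_scale_pi // rmorphM => /eqP.
  by rewrite mulf_eq0 (negPf (monic_neq0 (monic_map _ phim))) => /eqP.
have [|E' E1E' QE] := IH E1 Q.
  apply: (@scale_piX_inj 1); rewrite expr1 /= scalerA -exprS -EQ EE1.
  by rewrite scalerAr.
by exists E'; rewrite // EE1 E1E' scalerA exprS.
Qed.

(** The valuation of the leading coefficient bounds the powers of [pi] dividing [p]; a maximal one
    leaves a quotient with nonzero reduction. *)
Lemma pi_exact (p : {poly R}) : p != 0 ->
  exists t q, p = pi ^+ t *: q /\ rp q != 0.
Proof.
move=> p0; have [z vz] : exists z, v (val (lead_coef p)) = z%:E.
  apply: dval_fin; apply: contraNneq p0 => l0; rewrite -lead_coef_eq0.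
  by apply/eqP/val_inj.
pose P t := `[< exists q, p = pi ^+ t *: q >].
have P0 : exists t, P t by exists 0%N; apply/asboolP; exists p; rewrite expr0 scale1r.
have Pz t : P t -> (t <= `|z|)%N.
  move=> /asboolP[q pq]; move: vz; rewrite {1}pq lead_coefE coefZ rmorphM dvalM.
  rewrite rmorphXn (dval_pi vpi); have := valP (q`_(size (pi ^+ t *: q)).-1).
  rewrite inE; case: (v _) => [y| |] //=; rewrite lee_fin -EFinD => y0 [<-]; lia.
case: (ex_maxnP P0 Pz) => t /asboolP[q pq] tmax; exists t, q; split=> //.
apply/negP => /eqP/map_red_eq0[q' qq']; suff /tmax : P t.+1 by rewrite ltnn.
by apply/asboolP; exists q'; rewrite pq qq' scalerA exprSr.
Qed.

Lemma pi_exact_le t u (p q : {poly R}) :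
  pi ^+ t *: p = pi ^+ u *: q -> rp p != 0 -> (u <= t)%N.
Proof.
move=> pq; apply: contraNleq => tu; have : p = pi ^+ (u - t) *: q.
  by apply: (@scale_piX_inj t); rewrite /= scalerA -exprD subnKC // ltnW.
by move=> ->; rewrite map_red_scale_pi // subn_gt0.
Qed.

Variables n nu : nat.
Hypothesis n_gt0 : (0 < n)%N.

(* The coefficient p of phi^i has weight n * (Gauss valuation of p) + i * nu,
   where nu / n is the slope of the Newton polygon. *)
Definition weight_ge T i (p : {poly R}) :=
  exists t q, p = pi ^+ t *: q /\ (T <= n * t + i * nu)%N.

Lemma weight_ge0 T i : weight_ge T i 0.
Proof. by exists T, 0; rewrite scaler0; split=> //; nia. Qed.

Lemma weight_geD T i p q : weight_ge T i p -> weight_ge T i q -> weight_ge T i (p + q).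
Proof.
move=> [t [p' [-> tT]]] [u [q' [-> uT]]].
wlog tu : t p' tT u q' uT / (t <= u)%N => [hw|].
  have [tu|ut] := leqP t u; first exact: hw.
  by rewrite addrC; apply: hw => //; apply: ltnW.
exists t, (p' + pi ^+ (u - t) *: q'); split=> //.
by rewrite scalerDr scalerA -exprD subnKC.
Qed.

Lemma weight_geN T i p : weight_ge T i p -> weight_ge T i (- p).
Proof. by move=> [t [q [-> tT]]]; exists t, (- q); rewrite scalerN. Qed.

Lemma weight_geM T U i j p q :
  weight_ge T i p -> weight_ge U j q -> weight_ge (T + U) (i + j) (p * q).
Proof.
move=> [t [p' [-> tT]]] [u [q' [-> uT]]]; exists (t + u)%N, (p' * q'); split.
  by rewrite -scalerAl -scalerAr scalerA exprD.
by nia.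
Qed.

Lemma weight_ge_le T U i j p :
  weight_ge T i p -> (U <= T)%N -> (i <= j)%N -> weight_ge U j p.
Proof. by move=> [t [q [-> tT]]] UT ij; exists t, q; split=> //; nia. Qed.

Lemma weight_ge_sum T i (I : finType) (P : pred I) (F : I -> {poly R}) :
  (forall j, P j -> weight_ge T i (F j)) -> weight_ge T i (\sum_(j | P j) F j).
Proof.
move=> h; elim/big_ind: _ => //; [exact: weight_ge0|move=> *; exact: weight_geD].
Qed.

Lemma weight_ge_scale T i t s (p : {poly R}) :
  weight_ge T i p -> (n * t + s * nu < T)%N -> (i <= s)%N ->
  exists q, p = pi ^+ t.+1 *: q.
Proof.
move=> [u [q [-> uT]]] tT ij; have tu : (t < u)%N by nia.
by exists (pi ^+ (u - t.+1) *: q); rewrite scalerA -exprD subnKC.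
Qed.

Lemma weight_ge_monic (phi E : {poly R}) T i : phi \is monic ->
  weight_ge T i (phi * E) -> weight_ge T i E.
Proof.
move=> phim [t [q [/(monic_mul_pi phim)[E' -> _] tT]]].
by exists t, E'.
Qed.

(* The leading part of D, a phi-adic expansion of 0, at its least index is
   divisible by phi modulo pi: the process of carrying goes upwards and
   multiplication by phi preserves the Gauss valuation. *)
Lemma carry_dvd (phi : {poly R}) (D : {poly {poly R}}) s t b r :
  phi \is monic -> root D phi ->
  (forall i, (i < s)%N -> weight_ge (n * t + s * nu).+1 i D`_i) ->
  D`_s = pi ^+ t *: b + r -> weight_ge (n * t + s * nu).+1 s r ->
  rp phi %| rp b.
Proof.
move=> phim /factor_theorem[E DE] Dlow Ds hr; set T := (_ + _)%N in Dlow hr.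
have phiE i : phi * E`_i = ('X * E)`_i - D`_i.
  by rewrite DE mulrBr coefB coefMC commr_polyX; ring.
(* The relation [phi * E_i = E_(i-1) - D_i] carries the bound upwards, since the weight of a fixed
   polynomial does not decrease with its index. *)
have Elow i : (i < s)%N -> weight_ge T.+1 i E`_i.
  elim: i => [|i IH] lis; apply: (weight_ge_monic phim); rewrite phiE coefXM /=.
    by rewrite sub0r; apply: weight_geN; apply: Dlow.
  apply: weight_geD; last by apply: weight_geN; apply: Dlow.
  by apply: (weight_ge_le (IH (ltnW lis))).
have [Q QE] : exists Q, ('X * E)`_s - r = pi ^+ t.+1 *: Q.
  apply: (@weight_ge_scale T.+1 s _ s) => //; apply: weight_geD; last exact: weight_geN.
  rewrite coefXM; case: (s) Elow => [|s'] Elow /=; first exact: weight_ge0.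
  by apply: (weight_ge_le (Elow s' _)).
(* At index [s] this reads [phi * E_s = pi ^+ t *: (pi *: Q - b)]; after division by [pi ^+ t],
   reduction gives a multiple of [rp phi] equal to [- rp b]. *)
have [|E' _ hE'] := @monic_mul_pi phi E`_s (pi *: Q - b) t phim.
  by rewrite phiE Ds opprD addrCA QE addrC scalerBr scalerA -exprSr.
have := congr1 rp hE'; rewrite rmorphM rmorphB /= -[pi]expr1 map_red_scale_pi // sub0r.
by move=> h; rewrite -dvdpNr -h dvdp_mulIl.
Qed.

End Weights.

(** * The Newton polygons of two factors *)

Section NewtonPolygon.
Variables (K : fieldType) (v : dvaluation K).
Local Notation R := (vint v).
Local Notation rp := (map_poly (@red K v)).
Variable pi : R.
Hypothesis vpi : v (val pi) = 1%:E.
Lemma size_scale_pi t (p : {poly R}) : size (pi ^+ t *: p) = size p.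
Proof.
apply/eqP; rewrite eqn_leq size_scale_leq; apply/leq_sizeP => j hj.
have /(congr1 val)/eqP : (pi ^+ t *: p)`_j = 0 by apply: nth_default.
rewrite coefZ rmorphM rmorphXn rmorph0 mulf_eq0 expf_eq0.
by rewrite (negPf (uniformizer_neq0 vpi)) andbF => /eqP h; apply: val_inj.
Qed.

Variables n nu : nat.
Hypothesis n_gt0 : (0 < n)%N.
Local Notation weight_ge := (weight_ge pi n nu).

(** [n * t + i * nu] is the level of the supporting line of slope [- nu / n] of the Newton polygon,
    and [i] its leftmost point of contact. The leading coefficient 1 at index [k] bounds the level
    by [k * nu]. *)
Lemma least_weight (G : {poly {poly R}}) k : G \is monic -> size G = k.+1 ->
  exists i t b, [/\ forall j, weight_ge (n * t + i * nu) j G`_j,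
    forall j, (j < i)%N -> weight_ge (n * t + i * nu).+1 j G`_j,
    G`_i = pi ^+ t *: b, rp b != 0 & (n * t + i * nu <= k * nu)%N].
Proof.
move=> Gm sG; have Gk : G`_k = 1 by move: Gm; rewrite monicE lead_coefE sG => /eqP.
have rp1 : rp 1 != 0 by rewrite rmorph1 oner_neq0.
pose P T := `[< forall j, weight_ge T j G`_j >].
have P0 : exists T, P T.
  by exists 0%N; apply/asboolP => j; exists 0%N, G`_j; rewrite expr0 scale1r.
have Pk T : P T -> (T <= k * nu)%N.
  move=> /asboolP/(_ k); rewrite Gk => -[t [q [tq tT]]].
  suff : (t <= 0)%N by nia.
  by apply: (pi_exact_le vpi _ rp1); rewrite expr0 scale1r tq.
case: (ex_maxnP P0 Pk) => T PT Tmax; have {PT} PT := asboolW PT.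
have : exists i, ~~ `[< weight_ge T.+1 i G`_i >].
  apply/not_existsP => h; suff /Tmax : P T.+1 by rewrite ltnn.
  by apply/asboolP => j; apply/asboolP/negPn/negP/h.
move=> /ex_minnP[i /asboolPn iT imin].
have Gi0 : G`_i != 0 by apply: contra_notN iT => /eqP ->; apply: weight_ge0.
have [t [b [Gi b0]]] := pi_exact vpi Gi0.
have TE : T = (n * t + i * nu)%N.
  apply/eqP; rewrite eqn_leq; apply/andP; split; last first.
    by rewrite leqNgt; apply: contra_notN iT => iT; exists t, b.
  have [u [q [Giq uT]]] := PT i; apply: leq_trans uT _.
  have : (u <= t)%N by apply: (pi_exact_le vpi _ b0); rewrite -Gi Giq.
  by move=> ut; rewrite leq_add2r leq_mul2l ut orbT.
exists i, t, b; rewrite -TE; split=> // [j ji|]; last exact/Pk/asboolP.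
by apply/asboolP; apply: contraTT ji => /imin; rewrite -leqNgt.
Qed.

(* The sum T + U of the least weights of G and H is at least n * nu: otherwise
   carry_dvd at the sum of the least indices makes phi divide, modulo pi, a
   product of two nonzero polynomials of degree < m. *)
Lemma factor_newton (phi delta a0 : {poly R}) (G H A : {poly {poly R}}) k l m :
  phi \is monic -> size phi = m.+1 -> irreducible_poly (rp phi) ->
  G \is monic -> size G = k.+1 -> (forall i, (size (G`_i)%R <= m)%N) ->
  H \is monic -> size H = l.+1 -> (forall i, (size (H`_i)%R <= m)%N) ->
  (k + l = n)%N -> (forall i, weight_ge (n * nu) i A`_i) ->
  A`_0 = pi ^+ nu *: a0 -> rp a0 != 0 -> (size a0 <= m)%N ->
  weight_ge (n * nu).+1 0 delta -> A.[phi] = G.[phi] * H.[phi] + delta ->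
  exists t, (n * t = k * nu)%N.
Proof.
move=> phim sphi phiirr Gm sG Gs Hm sH Hs kln hA A0 a00 sa0 hd hAGH.
have small (b : {poly R}) : (size b <= m)%N -> rp b != 0 -> ~~ (rp phi %| rp b).
  move=> sb b0; apply: contraTN isT => /dvdp_leq -/(_ b0).
  have -> : size (rp phi) = m.+1.
    by rewrite size_map_poly_id0 // (eqP phim) rmorph1 oner_neq0.
  by move=> /leq_trans/(_ (size_poly _ _))/leq_trans/(_ sb); rewrite ltnn.
pose D := G * H + delta%:P - A.
have rD : root D phi by rewrite /root !hornerE hAGH; apply/eqP; ring.
have [i [t [b [Gge Ggt Gi b0 tk]]]] := least_weight Gm sG.
have [j [u [c [Hge Hgt Hj c0 ul]]]] := least_weight Hm sH.
set T := (n * t + i * nu)%N in Gge Ggt tk; set U := (n * u + j * nu)%N in Hge Hgt ul.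
have TU : (n * nu <= T + U)%N.
  rewrite leqNgt; apply/negP => TU.
  have hdA s : weight_ge (T + U).+1 s (delta%:P`_s - A`_s).
    apply: weight_geD; last by apply: weight_geN; apply: (weight_ge_le n_gt0 (hA s)).
    rewrite coefC; case: eqP => _; last exact: weight_ge0.
    by apply: (weight_ge_le n_gt0 hd) => //; apply: leqW.
  have TUE : (n * (t + u) + (i + j) * nu = T + U)%N by rewrite /T /U; ring.
  (* For [s < i + j] every pair [(x, s - x)] satisfies the condition, for [s = i + j] every pair but
     [(i, j)]; so only [b * c] survives in lowest weight. *)
  have prod_gt s (x : 'I_s.+1) : (x < i)%N || (s - x < j)%N ->
      weight_ge (T + U).+1 s (G`_x * H`_(s - x)).
    have xs : (x + (s - x) <= s)%N by rewrite subnKC // -ltnS.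
    case/orP => h.
      by apply: (weight_ge_le n_gt0 (weight_geM n_gt0 (Ggt _ h) (Hge (s - x)%N))).
    by rewrite -addnS; apply: (weight_ge_le n_gt0 (weight_geM n_gt0 (Gge x) (Hgt _ h))).
  have /negP[] : ~~ (rp phi %| rp (b * c)).
    rewrite rmorphM /=; have cop := irreducible_poly_coprime _ phiirr.
    rewrite -cop coprimepMr !cop !small //.
      by rewrite -(size_scale_pi u) -Hj.
    by rewrite -(size_scale_pi t) -Gi.
  apply: (@carry_dvd _ v pi vpi n nu n_gt0 phi D (i + j) (t + u) (b * c)
    (\sum_(x < (i + j).+1 | x != inord i) G`_x * H`_(i + j - x)
      + (delta%:P`_(i + j) - A`_(i + j)))) => //; rewrite ?TUE.
  - move=> s sij; rewrite /D -addrA coefD coefB; apply: weight_geD => //.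
    rewrite coefM; apply: (weight_ge_sum n_gt0) => // x _; apply: prod_gt.
    by case: ltnP => //= ix; rewrite ltn_subLR -1?ltnS //; lia.
  - rewrite /D -addrA coefD coefB coefM (bigD1 (inord i)) //= inordK ?ltnS ?leq_addr //.
    by rewrite addKn Gi Hj -scalerAl -scalerAr scalerA -exprD !addrA.
  - apply: weight_geD => //; apply: (weight_ge_sum n_gt0) => // x xi; apply: prod_gt.
    have {xi} : (x : nat) != i.
      apply: contraNneq xi => xi; apply/eqP/val_inj.
      by rewrite /= inordK ?ltnS ?leq_addr.
    by have := ltn_ord x; lia.
(* The bounds [T <= k * nu] and [U <= l * nu] add up to [n * nu], which is at most [T + U]. *)
have [T0 U0] : T = (k * nu)%N /\ U = (l * nu)%N by nia.
have [t0 [g0 [G0 t0k]]] := Gge 0%N; have [u0 [h0 [H0 u0l]]] := Hge 0%N.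
rewrite T0 U0 !mul0n !addn0 in t0k u0l.
(* If [n * t0] exceeded [k * nu], the product of the constant terms would have weight above
   [n * nu]; then [- a0] would be the leading part of [D] at index 0, and [phi] would divide [a0]
   modulo [pi], against the degrees. *)
exists t0; apply/eqP; rewrite eqn_leq t0k andbT leqNgt; apply/negP => t0gt.
have /negP[] := small _ sa0 a00.
rewrite -dvdpNr -rmorphN.
apply: (@carry_dvd _ v pi vpi n nu n_gt0 phi D 0 nu (- a0) (G`_0 * H`_0 + delta)) => //.
  by rewrite /D coefB coefD coefC coefM big_ord_recl big_ord0 addr0 A0 scalerN addrC.
rewrite mul0n addn0; apply: weight_geD => //.
exists (t0 + u0)%N, (g0 * h0); split; last by nia.
by rewrite G0 H0 -scalerAl -scalerAr scalerA exprD.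
Qed.

End NewtonPolygon.

(** * Divisors of powers of an irreducible polynomial, and [phi]-expansions *)

Section Expansion.

(** Induction on [k]: one factor [p] is cancelled from [g], or from [h] when [p] is coprime to
    [g]. *)
Lemma size_dvd_irreducible_exp (F : fieldType) (p g h : {poly F}) k m :
    irreducible_poly p -> size p = m.+1 -> g * h = p ^+ k ->
  exists i, size g = (i * m).+1.
Proof.
move=> pirr sp; have p0 : p != 0 by rewrite -size_poly_eq0 sp.
elim: k g h => [|k IH] g h gh.
  exists 0%N; apply/eqP; rewrite mul0n -dvdp1 -(expr0 p) -gh; exact: dvdp_mulr.
have [/dvdpP[q qg]|pg] := boolP (p %| g).
  have [i si] : exists i, size q = (i * m).+1.
    apply: (IH q h); apply: (mulIf p0); rewrite -exprSr -gh qg; ring.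
  exists i.+1; rewrite qg size_mul ?si ?sp //; first by rewrite mulSn; lia.
  by rewrite -size_poly_eq0 si.
have /dvdpP[q qh] : p %| h.
  rewrite -(Gauss_dvdpr _ (_ : coprimep p g)) ?irreducible_poly_coprime // gh.
  by rewrite exprS dvdp_mulIl.
by apply: (IH g q); apply: (mulIf p0); rewrite -exprSr -gh qh; ring.
Qed.

Variables (R : comNzRingType) (phi : {poly R}) (m : nat).
Hypotheses (phi_monic : phi \is monic) (phi_size : size phi = m.+1).

Lemma size_monic_exp k : size (phi ^+ k) = (k * m).+1.
Proof.
elim: k => [|k IH]; first by rewrite expr0 size_poly1.
rewrite exprSr size_Mmonic ?IH ?phi_size ?mulSn //; first by lia.
by rewrite -size_poly_eq0 IH.
Qed.

(** Since [m] divides the degree of [g], each quotient by [phi] is again monic of degree a multiple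
    of [m], and the last one is 1; this makes [G] monic. *)
Lemma monic_expansion k (g : {poly R}) : (0 < m)%N ->
    g \is monic -> size g = (k * m).+1 ->
  exists G : {poly {poly R}}, [/\ G \is monic, size G = k.+1,
    forall i, (size (G`_i)%R <= m)%N & G.[phi] = g].
Proof.
move=> m0; elim: k g => [|k IH] g gm sg.
  exists 1; split; rewrite ?monic1 ?size_poly1 ?hornerC //.
    by move=> i; rewrite coef1; case: eqP => _; rewrite ?size_poly1 ?size_poly0.
  by move: gm; rewrite monicE (size1_polyC (eq_leq sg)) lead_coefC => /eqP ->.
set q := Pdiv.Ring.rdivp g phi; set r := Pdiv.Ring.rmodp g phi.
have gE : g = q * phi + r := Pdiv.RingMonic.rdivp_eq phi_monic g.
have sr : (size r <= m)%N.
  by rewrite -ltnS -phi_size Pdiv.Ring.ltn_rmodp monic_neq0.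
have srg : (size (- r)%R < size g)%N by rewrite size_polyN sg; nia.
have qphi : q * phi = g - r by rewrite gE addrK.
have sqphi : size (q * phi) = (k.+1 * m).+1 by rewrite qphi size_polyDl.
have q0 : q != 0.
  by apply/eqP => q0; move: sqphi; rewrite q0 mul0r size_poly0.
have qm : q \is monic.
  by rewrite monicE -(lead_coef_Mmonic _ phi_monic) qphi lead_coefDl.
have sq : size q = (k * m).+1.
  by move: sqphi; rewrite size_Mmonic // phi_size mulSn addnS /=; lia.
have [G [Gm sG Gs Gq]] := IH q qm sq.
have G0 : G != 0 by apply: monic_neq0.
have sGr : size (G * 'X + r%:P) = k.+2 by rewrite size_MXaddC (negPf G0) sG.
exists (G * 'X + r%:P); split=> //.
- move: Gm; rewrite !monicE !lead_coefE sGr sG /= coefD coefMX coefC /=.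
  by rewrite addr0.
- move=> i; rewrite coefD coefMX coefC.
  by case: i => [|i] /=; rewrite ?add0r ?addr0.
- by rewrite hornerMXaddC Gq -gE.
Qed.

End Expansion.

(** The minimum is attained at a coefficient of [q] with nonzero residue, that is, of valuation
    0. *)
Lemma gauss_exact (K : fieldType) (v : dvaluation K) (pi : vint v)
    (p q : {poly vint v}) t :
  v (val pi) = 1%:E -> p = pi ^+ t *: q -> map_poly (@red K v) q != 0 ->
  gauss p = t%:Z%:E.
Proof.
move=> vpi pq q0.
have [i ri] : exists i, (map_poly (@red K v) q)`_i != 0.
  apply/not_existsP => h; move: q0 => /negP[]; apply/eqP/polyP => i.
  by rewrite coef0; apply/eqP/negPn/negP/h.
have vp j : v (val p`_j) = (t%:Z%:E + v (val q`_j))%E.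
  by rewrite pq coefZ rmorphM rmorphXn /= dvalM (dval_pi vpi).
have vqi : v (val q`_i) = 0%E.
  move: ri; rewrite coef_map /= red_eq0 inE -leNgt => qi.
  by apply/eqP; rewrite eq_le qi; apply: (valP q`_i).
have ip : (i < size p)%N.
  rewrite ltnNge; apply/negP => ip; have := vp i; rewrite nth_default //.
  by rewrite rmorph0 dval0 vqi adde0.
rewrite /gauss; apply/eqP; rewrite eq_le; apply/andP; split.
  have := @bigmin_le _ _ 'I_(size p) +oo%E (Ordinal ip) (fun i => v (val p`_i)).
  by rewrite /= vp vqi adde0.
apply: le_bigmin => [|j _]; first by rewrite leey.
by rewrite vp leeDl //; apply: (valP q`_j).
Qed.

(** * Approximation of polynomials over [R_v], and Gauss' lemma *)

Section Approximation.
Variables (K : fieldType) (v : dvaluation K) (L : fieldType) (O : {pred L}).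
Variable iota : {rmorphism K -> L}.
Hypotheses (hO : valuation_subring O).
Hypothesis iotaO : valued_embedding (vring v) O iota.
Variable pi : vint v.
Hypothesis vpi : v (val pi) = 1%:E.
Local Notation S := (valuation_pred hO).
Local Notation P := (iota (val pi)).
Local Notation rp := (map_poly (@red K v)).
Local Notation j := (map_poly (iota \o val)).
Local Notation adherent := (adherent O iota (val pi)).

Let P0 : P != 0 := pi_neq0 iota vpi.
Let PO : P \in O.
Proof. by apply: maximal_sub; apply: (pi_maximal iotaO vpi). Qed.

Let polyB p q :
  p \is a polyOver O -> q \is a polyOver O -> p - q \is a polyOver O.
Proof.
by move=> pO qO; exact: (rpredB (pO : p \is a polyOver S) (qO : q \is a polyOver S)).
Qed.

Let polyD p q :
  p \is a polyOver O -> q \is a polyOver O -> p + q \is a polyOver O.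
Proof.
by move=> pO qO; exact: (rpredD (pO : p \is a polyOver S) (qO : q \is a polyOver S)).
Qed.

Let polyM p q :
  p \is a polyOver O -> q \is a polyOver O -> p * q \is a polyOver O.
Proof.
by move=> pO qO; exact: (rpredM (pO : p \is a polyOver S) (qO : q \is a polyOver S)).
Qed.

Lemma polyOver_map_vint (G : {poly vint v}) : j G \is a polyOver O.
Proof.
apply/(@polyOverP _ S) => i; rewrite coef_map /= /valuation_pred iotaO.
exact: valP.
Qed.

Lemma poly_approx (g : {poly L}) N :
    g \is a polyOver O -> (forall i, adherent g`_i) ->
  exists (G : {poly vint v}) (D : {poly L}),
    [/\ (size G <= size g)%N, D \is a polyOver O & g = j G + P ^+ N *: D].
Proof.
move=> /(@polyOverP _ S) gO ga.
have ha i : exists a : vint v, (g`_i - iota (val a)) / P ^+ N \in O.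
  have [a aN] := ga i N; have aO : a \in vring v.
    rewrite -iotaO; have -> : iota a = g`_i - (g`_i - iota a) / P ^+ N * P ^+ N.
      by rewrite divfK ?expf_neq0 // opprB addrC subrK.
    apply: (@rpredB _ S); first exact: gO.
    by apply: (@rpredM _ S) => //; apply: (@rpredX _ S).
  by exists (VInt aO).
have [a aP] := choice ha.
exists (\poly_(i < size g) a i).
exists (\poly_(i < size g) ((g`_i - iota (val (a i))) / P ^+ N)); split.
- exact: size_poly.
- apply/(@polyOverP _ S) => i; rewrite coef_poly.
  by case: ifP => _; [apply: aP|apply: (rpred0 S)].
apply/polyP => i; rewrite coefD coefZ coef_map !coef_poly.
case: ltnP => ig /=; last by rewrite nth_default // rmorph0 mulr0 addr0.
by rewrite mulrC divfK ?expf_neq0 // addrC subrK.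
Qed.

(** Only [g - 'X^d] is approximated, so that the leading term is kept exactly. *)
Lemma monic_approx (g : {poly L}) N :
    g \is monic -> g \is a polyOver O -> (forall i, adherent g`_i) ->
  exists (G : {poly vint v}) (D : {poly L}),
    [/\ G \is monic, size G = size g, D \is a polyOver O
      & g = j G + P ^+ N *: D].
Proof.
move=> gm gO ga; have g0 := monic_neq0 gm.
pose d := (size g).-1; have sg : size g = d.+1 by rewrite prednK // size_poly_gt0.
have gd : g`_d = 1 by move: gm; rewrite monicE lead_coefE => /eqP.
have sg' : (size (g - 'X^d)%R <= d)%N.
  apply/leq_sizeP => i; rewrite leq_eqVlt coefB coefXn => /predU1P[<-|di].
    by rewrite gd eqxx subrr.
  by rewrite nth_default ?sg // gtn_eqF // subrr.
have [||G [D [sG DO gE]]] := @poly_approx (g - 'X^d) N.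
- by apply: polyB => //; apply: (@polyOverXn _ S).
- move=> i; rewrite coefB coefXn; apply: (adherentB hO) => //.
  by rewrite -(rmorph_nat iota); apply: (adherentK iota hO).
have sXG : (size G < size ('X^d : {poly vint v}))%N.
  by rewrite size_polyXn ltnS (leq_trans sG).
exists ('X^d + G), D; split=> //.
- by rewrite monicE lead_coefDl // lead_coefXn.
- by rewrite size_polyDl // size_polyXn.
have -> : j ('X^d + G) = 'X^d + j G.
  by rewrite rmorphD; congr (_ + _); apply: map_polyXn.
by rewrite -addrA -gE addrC subrK.
Qed.

(** Divisibility over [O] descends because [O] pulls back to [vring v]. *)
Lemma map_vint_dvd (G : {poly vint v}) (D : {poly L}) N :
  j G = P ^+ N *: D -> D \is a polyOver O -> exists G', G = pi ^+ N *: G'.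
Proof.
move=> /polyP GD /(@polyOverP _ S) DO.
have ha i : exists a, G`_i = pi ^+ N * a.
  have aO : val G`_i / val pi ^+ N \in vring v.
    rewrite -iotaO fmorph_div rmorphXn.
    have := GD i; rewrite coef_map coefZ /= => ->.
    by rewrite mulrC mulKf ?expf_neq0 //; apply: DO.
  exists (VInt aO); apply: val_inj; rewrite rmorphM rmorphXn /= mulrC divfK //.
  by rewrite expf_neq0 // (uniformizer_neq0 vpi).
have [a aP] := choice ha; exists (\poly_(i < size G) a i).
apply/polyP => i; rewrite coefZ coef_poly; case: ltnP => [//|iG].
by rewrite nth_default // mulr0.
Qed.

(** Take the least [s] for which [P ^+ s *: g] is integral: if [G] reduced to 0, a factor [P] could
    be removed. *)
Lemma primitive_approx (g : {poly L}) :
    g \is monic -> (forall i, adherent g`_i) ->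
  exists s (G : {poly vint v}) (D : {poly L}),
    [/\ P ^+ s *: g \is a polyOver O, D \is a polyOver O,
        P ^+ s *: g = j G + P *: D & rp G != 0].
Proof.
move=> gm ga.
pose Q s := P ^+ s *: g \is a polyOver O.
have PXO s : P ^+ s \in O by apply: (@rpredX _ S).
have exQ : exists s, Q s.
  have hb (i : 'I_(size g)) : exists s, g`_i * P ^+ s \in O.
    exact: (adherent_clear hO iotaO vpi (ga i)).
  have [b bP] := choice hb; exists (\max_i b i); apply/(@polyOverP _ S) => i.
  rewrite coefZ mulrC; have [ig|ig] := ltnP i (size g); last first.
    by rewrite nth_default // mul0r (rpred0 S).
  have -> : \max_i b i = (b (Ordinal ig) + (\max_i b i - b (Ordinal ig)))%N.
    by rewrite subnKC // leq_bigmax.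
  by rewrite exprD mulrA; apply: (@rpredM _ S) => //; apply: (bP (Ordinal ig)).
case: (ex_minnP exQ) => s Qs smin.
have ga' i : adherent (P ^+ s *: g)`_i.
  rewrite coefZ; apply: (adherentM hO iotaO vpi) => //.
  by rewrite -rmorphXn; apply: (adherentK iota hO).
have [G [D [_ DO gE]]] := poly_approx 1 Qs ga'; rewrite expr1 in gE.
exists s, G, D; split=> //; apply/negP => /eqP /(map_red_eq0 vpi)[G' GG'].
have {}gE : P ^+ s *: g = P *: (j G' + D).
  by rewrite gE GG' map_polyZ /= scalerDr.
have D'O : j G' + D \is a polyOver O.
  by apply: polyD => //; apply: polyOver_map_vint.
case: s Qs smin ga' gE => [|s] Qs smin ga' gE.
  (* For [s = 0] minimality says nothing; instead, the leading coefficient 1 of [g] would be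
     divisible by [P]. *)
  have := congr1 (fun p : {poly L} => p`_(size g).-1) gE.
  rewrite expr0 scale1r coefZ -lead_coefE (eqP gm) => h.
  have := pi_maximal iotaO vpi; rewrite inE (negPf P0) /= => /andP[_ /negP[]].
  by rewrite -[P^-1]mulr1 h mulKf //; apply: (@polyOverP _ S _ D'O).
suff /smin : Q s by rewrite ltnn.
rewrite /Q; have -> // : P ^+ s *: g = j G' + D.
by rewrite -[RHS](scale1r) -(mulVf P0) -scalerA -gE scalerA exprS mulKf.
Qed.

(* Gauss' lemma: both factors are made primitive and approximated over K, whose
   residue polynomial ring is a domain. *)
Lemma monic_factor_integral (f : {poly vint v}) (g h : {poly L}) :
    g \is monic -> h \is monic -> (forall i, adherent g`_i) ->
    (forall i, adherent h`_i) -> g * h = j f ->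
  g \is a polyOver O.
Proof.
move=> gm hm ga ha gh.
have [s [G [D [gO DO gE G0]]]] := primitive_approx gm ga.
have [t [H [E [hO' EO hE H0]]]] := primitive_approx hm ha.
(* For [s = 0], [g] is already integral. Otherwise the product of the scaled factors is
   [P ^+ (s.+1 + t) *: j f], divisible by [P], so that [rp G * rp H] would vanish. *)
case: s gO gE => [|s] gO gE; first by rewrite expr0 scale1r in gO.
have jGH : j (G * H) = P ^+ 1 *: (P ^+ (s + t) *: j f - j G * E - D * (P ^+ t *: h)).
  have -> : P ^+ 1 *: (P ^+ (s + t) *: j f - j G * E - D * (P ^+ t *: h))
    = (P ^+ s.+1 *: g) * (P ^+ t *: h) - (P *: D) * (P ^+ t *: h) - j G * (P *: E).
    rewrite -gh expr1 !scalerBr !scalerA -exprS -!scalerAl -!scalerAr !scalerA.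
    by rewrite -exprD addSn addrAC.
  by rewrite gE hE -mulrBl addrK -mulrBr addrK rmorphM.
have [|GH' GHE] := map_vint_dvd jGH.
  have Pf : P ^+ (s + t) *: j f \is a polyOver O.
    apply: (@polyOverZ _ S); last exact: polyOver_map_vint.
    exact: (@rpredX _ S).
  apply: polyB; last exact: polyM.
  apply: polyB => //; apply: polyM => //.
  exact: polyOver_map_vint.
have /eqP := congr1 rp GHE; rewrite (map_red_scale_pi vpi) // rmorphM mulf_eq0.
by rewrite (negPf G0) (negPf H0).
Qed.

End Approximation.

(** * The degree of a factor with adherent coefficients *)

Section FactorDegree.
Variables (K : fieldType) (v : dvaluation K) (L : fieldType) (O : {pred L}).
Variable iota : {rmorphism K -> L}.
Hypotheses (hO : valuation_subring O).
Hypothesis iotaO : valued_embedding (vring v) O iota.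
Variable pi : vint v.
Hypothesis vpi : v (val pi) = 1%:E.
Local Notation P := (iota (val pi)).
Local Notation rp := (map_poly (@red K v)).
Local Notation j := (map_poly (iota \o val)).
Local Notation adherent := (adherent O iota (val pi)).

Lemma factor_degree (phi f a0 : {poly vint v}) (A : {poly {poly vint v}})
    (m n nu : nat) (g h : {poly L}) :
    phi \is monic -> size phi = m.+1 -> irreducible_poly (rp phi) ->
    f \is monic -> (exists k, rp f = rp phi ^+ k) -> size f = (n * m).+1 ->
    (0 < n)%N -> (forall i, weight_ge pi n nu (n * nu) i A`_i) ->
    A`_0 = pi ^+ nu *: a0 -> rp a0 != 0 -> (size a0 <= m)%N -> A.[phi] = f ->
    g \is monic -> h \is monic -> (forall i, adherent g`_i) ->
    (forall i, adherent h`_i) -> g * h = j f ->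
  exists k t, size g = (k * m).+1 /\ (n * t = k * nu)%N.
Proof.
move=> phim sphi phiirr fm [k' fk'] sf n0 hA A0 a00 sa0 Af gm hm ga ha gh.
have rp_size (p : {poly vint v}) : p \is monic -> size (rp p) = size p.
  by move=> /eqP pm; rewrite size_map_poly_id0 // pm rmorph1 oner_neq0.
have m0 : (0 < m)%N.
  by have := phiirr.1; rewrite (rp_size _ phim) sphi.
have gO := monic_factor_integral hO iotaO vpi gm hm ga ha gh.
have hO' : h \is a polyOver O.
  by apply: (monic_factor_integral hO iotaO vpi hm gm ha ga); rewrite mulrC gh.
(* Precision [nu.+1] gives the error [delta] weight at least [n * nu.+1], strictly above [n * nu] as
   [n] is positive. *)
have [G [D [Gm sG DO gE]]] := monic_approx hO iotaO vpi nu.+1 gm gO ga.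
have [H [E [Hm sH EO hE]]] := monic_approx hO iotaO vpi nu.+1 hm hO' ha.
have fGH : j (f - G * H) = P ^+ nu.+1 *: (j G * E + D * h).
  have -> : j (f - G * H) = g * h - j G * j H by rewrite gh rmorphB rmorphM.
  have -> : P ^+ nu.+1 *: (j G * E + D * h) = j G * (h - j H) + (g - j G) * h.
    have -> : g - j G = P ^+ nu.+1 *: D by rewrite gE addrAC subrr add0r.
    have -> : h - j H = P ^+ nu.+1 *: E by rewrite hE addrAC subrr add0r.
    by rewrite scalerDr scalerAr scalerAl.
  by ring.
have [|delta deltaE] := map_vint_dvd hO iotaO vpi fGH.
  apply: (rpredD (_ : _ \is a polyOver (valuation_pred hO))).
    apply: (rpredM (_ : _ \is a polyOver (valuation_pred hO))) => //.
    exact: polyOver_map_vint.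
  exact: (rpredM (_ : _ \is a polyOver (valuation_pred hO))).
have rpGH : rp G * rp H = rp phi ^+ k'.
  have := congr1 rp deltaE; rewrite (map_red_scale_pi vpi) // rmorphB rmorphM /= fk'.
  by move=> /eqP; rewrite subr_eq0 => /eqP.
have srphi : size (rp phi) = m.+1 by rewrite rp_size.
have [k sk] := size_dvd_irreducible_exp phiirr srphi rpGH.
have [l sl] := size_dvd_irreducible_exp phiirr srphi (etrans (mulrC _ _) rpGH).
rewrite (rp_size _ Gm) in sk; rewrite (rp_size _ Hm) in sl.
have kln : (k + l = n)%N.
  have : (size (rp G * rp H)) = (n * m).+1 by rewrite rpGH -fk' rp_size.
  rewrite -rmorphM rp_size ?monicMl // size_Mmonic ?monic_neq0 // sk sl.
  by rewrite addnS /= => -[]; rewrite -mulnDl => /eqP; rewrite eqn_pmul2r // => /eqP.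
have [G' [G'm sG' G's G'g]] := monic_expansion phim sphi m0 Gm sk.
have [H' [H'm sH' H's H'h]] := monic_expansion phim sphi m0 Hm sl.
have [||t tk] := @factor_newton _ v pi vpi n nu n0 phi (pi ^+ nu.+1 *: delta) a0
  G' H' A k l m phim sphi phiirr G'm sG' G's H'm sH' H's kln hA A0 a00 sa0.
- exists nu.+1, delta; split; first by [].
  by rewrite mul0n addn0 mulnS -add1n leq_add2r.
- by rewrite Af G'g H'h -deltaE addrC subrK.
by exists k, t; rewrite -sG sk.
Qed.

End FactorDegree.

(** * Counting the irreducible factors by their degrees *)

Lemma size_prod_monic_ge (F : fieldType) (c : nat) (gs : seq {poly F}) :
    (forall g, g \in gs -> g \is monic /\ (c <= (size g).-1)%N) ->
  \prod_(g <- gs) g \is monic /\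
  (size gs * c <= (size (\prod_(g <- gs) g)%R).-1)%N.
Proof.
elim: gs => [|g gs IH] hgs; first by rewrite big_nil monic1.
have [|pm ps] := IH; first by move=> x xgs; apply: hgs; rewrite inE xgs orbT.
have [gm gc] := hgs g (mem_head _ _); rewrite big_cons /=; split.
  by rewrite monicMl.
rewrite size_Mmonic ?monic_neq0 // mulSn.
have g0 : (0 < size g)%N by rewrite size_poly_gt0 monic_neq0.
have p0 : (0 < size (\prod_(x <- gs) x)%R)%N by rewrite size_poly_gt0 monic_neq0.
by rewrite -(prednK g0) -(prednK p0) addSn addnS /= leq_add.
Qed.

(** After division by the gcd, [n / d] divides [k * (nu / d)] and is coprime to [nu / d]. *)
Lemma divn_gcd_dvd (n nu t k : nat) :
  (0 < n)%N -> (n * t = k * nu)%N -> (n %/ gcdn nu n %| k)%N.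
Proof.
move=> n0 ntk; have d0 : (0 < gcdn nu n)%N by rewrite gcdn_gt0 n0 orbT.
have cop : coprime (n %/ gcdn nu n) (nu %/ gcdn nu n).
  by rewrite /coprime -(eqn_pmul2r d0) muln_gcdl !divnK ?dvdn_gcdl ?dvdn_gcdr //
             mul1n gcdnC.
rewrite -(Gauss_dvdl _ cop) -(dvdn_pmul2r d0) -mulnA.
by rewrite !divnK ?dvdn_gcdl ?dvdn_gcdr // -ntk dvdn_mulr.
Qed.

Theorem theorem3p2
  (K : fieldType) (v : dvaluation K)
  (Kh : fieldType) (Oh : {pred Kh}) (iota : {rmorphism K -> Kh})
  (hKh : is_henselization (vring v) Oh iota)
  (phi f : {poly vint v}) (m n : nat) (a : nat -> {poly vint v})
  (phi_monic : phi \is monic)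
  (phi_deg : size phi = m.+1)
  (phi_irr : irreducible_poly (map_poly (@red K v) phi))
  (f_monic : f \is monic)
  (f_red : exists k : nat,
     map_poly (@red K v) f = map_poly (@red K v) phi ^+ k)
  (n_gt0 : (0 < n)%N)
  (a_deg : forall i, (i < n)%N -> (size (a i) <= m)%N)
  (f_exp : f = phi ^+ n + \sum_(i < n) a i * phi ^+ i)
  (a0_neq0 : a 0%N != 0) :
  let nu0 : int := fine (gauss (a 0%N)) in
  let lambda : rat := nu0%:~R / n%:R in
  let d : nat := gcdn `|nu0|%N n in
  let e : nat := (n %/ d)%N in
  (forall i, (i < n)%N ->
     ((nu0%:~R - i%:R * lambda)%:E <= er_map intr (gauss (a i)))%E) ->
  forall gs : seq {poly Kh},
    (forall g, g \in gs -> g \is monic /\ irreducible_poly g) ->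
    map_poly (iota \o val) f = \prod_(g <- gs) g ->
    (size gs <= d)%N /\
    (forall g, g \in gs -> (e * m <= (size g).-1)%N).
Proof.
move=> nu0 lambda d e hyp gs gsirr fprod.
have [iotaO hO] : valued_embedding (vring v) Oh iota /\ valuation_subring Oh.
  by case: hKh => [[]].
have [p vp] := dval_surj v 1.
have pO : p \in vring v by rewrite inE vp.
pose pi := VInt pO; have vpi : v (val pi) = 1%:E by [].
have m0 : (0 < m)%N.
  have := phi_irr.1; rewrite size_map_poly_id0 ?phi_deg //.
  by rewrite (eqP phi_monic) rmorph1 oner_neq0.
have [nu [a0 [a0E a00]]] := pi_exact vpi a0_neq0.
have nuE : nu0 = nu by rewrite /nu0 (gauss_exact vpi a0E a00).
have sa0 : (size a0 <= m)%N by rewrite -(size_scale_pi vpi nu) -a0E a_deg.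
pose A : {poly {poly vint v}} := 'X^n + \poly_(i < n) a i.
have AE i : A`_i = if (i < n)%N then a i else (i == n)%:R.
  rewrite coefD coefXn coef_poly; case: ltngtP => _; by rewrite ?add0r ?addr0.
have Aphi : A.[phi] = f by rewrite hornerD hornerXn horner_poly -f_exp.
have hA i : weight_ge pi n nu (n * nu) i A`_i.
  rewrite AE; case: ltnP => [i_n|_]; last first.
    case: eqP => [->|_]; last exact: weight_ge0.
    by exists 0%N, 1; rewrite expr0 scale1r; split=> //; rewrite muln0.
  have [->|ai0] := eqVneq (a i) 0; first exact: weight_ge0.
  have [t [q [aiE q0]]] := pi_exact vpi ai0; exists t, q; split=> //.
  (* Multiplied by [n], the slope hypothesis becomes [n * nu <= n * t + i * nu]. *)
  have := hyp i i_n; rewrite (gauss_exact vpi aiE q0) /= lee_fin nuE /lambda nuE.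
  have n0 : 0 < n%:R :> rat by rewrite ltr0n.
  rewrite -(ler_pM2r n0) mulrBl mulrA divfK ?gt_eqF // lerBlDr -!pmulrn.
  by rewrite -!natrM -natrD ler_nat mulnC [(t * n)%N]mulnC.
have sf : size f = (n * m).+1.
  have sphin := size_monic_exp phi_monic phi_deg n.
  rewrite f_exp size_polyDl sphin // ltnS; apply: (leq_trans (size_sum _ _ _)).
  apply/bigmax_leqP => i _; apply: leq_trans (size_polyMleq _ _) _.
  rewrite (size_monic_exp phi_monic phi_deg) addnS /=.
  apply: leq_trans (leq_add (a_deg i (ltn_ord i)) (leqnn _)) _.
  by rewrite -mulSn leq_mul2r ltn_ord orbT.
have [psi [psiE psia]] := henselization_adherent hKh vpi.
have degs g : g \in gs -> exists2 k, size g = (k * m).+1 & (e %| k)%N.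
  move=> ggs; pose h := \prod_(x <- rem g gs) x.
  have fgh : map_poly (iota \o val) f = g * h.
    by rewrite fprod /h (big_rem g ggs).
  have gm := (gsirr g ggs).1.
  have hm : h \is monic.
    have [|//] := @size_prod_monic_ge _ 0 (rem g gs).
    by move=> x /mem_rem/gsirr[].
  (* Applying [psi] makes all coefficients adherent, while it fixes [f] and preserves degrees. *)
  have psif : map_poly psi g * map_poly psi h = map_poly (iota \o val) f.
    transitivity (map_poly psi (map_poly (iota \o val) f)).
      by rewrite fgh rmorphM.
    by rewrite -map_poly_comp; apply: eq_map_poly => x; apply: psiE.
  have psia' (q : {poly Kh}) i : adherent Oh iota (val pi) (map_poly psi q)`_i.
    by rewrite coef_map; apply: psia.
  have A0 : A`_0 = pi ^+ nu *: a0 by rewrite AE n_gt0.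
  have psigm : map_poly psi g \is monic by rewrite monic_map.
  have psihm : map_poly psi h \is monic by rewrite monic_map.
  have [k [t [sg tk]]] := factor_degree hO iotaO vpi phi_monic phi_deg phi_irr
    f_monic f_red sf n_gt0 hA A0 a00 sa0 Aphi psigm psihm (psia' g) (psia' h) psif.
  exists k; first by rewrite -sg size_map_poly.
  by rewrite /e /d nuE absz_nat; apply: divn_gcd_dvd tk.
have dge g : g \in gs -> g \is monic /\ (e * m <= (size g).-1)%N.
  move=> ggs; have [gm girr] := gsirr g ggs; split=> //.
  (* An irreducible polynomial is not constant, so [k] is positive and [e %| k] yields [e <= k]. *)
  have [k sg /dvdn_leq ek] := degs g ggs; rewrite sg leq_mul2r ek ?orbT //.
  by have := girr.1; rewrite sg ltnS; case: (k).
split; last by move=> g /dge[].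
(* The degrees add up to [n * m = e * d * m], and each is at least [e * m]. *)
have [_] := size_prod_monic_ge dge; rewrite -fprod.
have -> : size (map_poly (iota \o val) f) = (n * m).+1.
  by rewrite size_map_poly_id0 ?sf // (eqP f_monic) rmorph1 oner_neq0.
have d_n : (d %| n)%N by apply: dvdn_gcdr.
have ed : (e * d)%N = n := divnK d_n.
have e0 : (0 < e)%N by move: n_gt0; rewrite -ed muln_gt0 => /andP[].
move: ed e0; move: (e) (d) => e' d' ed e0.
by rewrite -ed /= mulnA [(_ * e')%N]mulnC leq_pmul2r // leq_pmul2l.
Qed.
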